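(* Let rational parameters $a,b,u,v$ satisfy $$a\ge b>\frac{2a}{3},\qquad u\ge v>0,\qquad u+v\le b,\qquad a+u\le 2b.$$ Then the pair $$H_w=(0,a,2a,3b),\qquad H_r=(0,u,u+v)$$ is realized by the instance with three items $(b,4)$, two items $(a,6)$, and the two items $(u,1)$, $(v,2)$ (each given as (value, size)), with capacities $D=12$ and $R=3$.
   Context: For an instance with items of rational value $a_i\ge0$ and positive integer size $d_i$ and integer capacities $0\le R<D$, let $U^w(n)$ (respectively $U^r(n)$) be the maximum total value of an $n$-element set of items of total size at most $D$ (respectively at most $R$), with value $-\infty$ if there is none, and $U^w(0)=U^r(0)=0$. For $\alpha\in\{w,r\}$, the terminal count is $b_\alpha=\min\operatorname{arg\,max}_n U^\alpha(n)$, and the hull is the sequence on $\{0,\dots,b_\alpha\}$ obtained by evaluating at integers the upper concave hull of the points $(n,U^\alpha(n))$, $0\le n\le b_\alpha$. The instance realizes a pair $(H_w,H_r)$ of sequences on $\{0,\dots,b_w\}$, $\{0,\dots,b_r\}$ if its terminal counts are $b_w,b_r$ and its hulls are exactly $H_w$ (capacity $D$) and $H_r$ (capacity $R$). *)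

(* Defs.v *)
From HB Require Import structures.
From mathcomp Require Import all_boot all_order all_algebra.
From mathcomp Require Import constructive_ereal.
Set Implicit Arguments.
Unset Strict Implicit.
Unset Printing Implicit Defensive.
Import Order.TTheory GRing.Theory Num.Theory.
Local Open Scope ring_scope.

(* An item is a pair (value, size).  Distinct positions of [items] are distinct
   items, so an item listed three times is available three times. *)
Record instance := Instance {
  items : seq (rat * nat);
  capD : nat;
  capR : nat }.

Definition valid (I : instance) : Prop :=
  (forall p, p \in items I -> 0 <= p.1 /\ (0 < p.2)%N) /\ (capR I < capD I)%N.

Definition value (I : instance) (i : 'I_(size (items I))) : rat :=
  (tnth (in_tuple (items I)) i).1.

Definition weight (I : instance) (i : 'I_(size (items I))) : nat :=
  (tnth (in_tuple (items I)) i).2.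

(* The empty big maximum is -oo.  At n = 0 the only candidate is the empty set,
   so U I C 0 = 0 for every capacity C. *)
Definition U (I : instance) (C n : nat) : \bar rat :=
  \big[maxe/-oo%E]_(S : {set 'I_(size (items I))} |
      (#|S| == n) && (\sum_(i in S) weight i <= C)%N)
    (\sum_(i in S) value i)%:E.

Definition is_argmax (f : nat -> \bar rat) (n : nat) : Prop :=
  forall m, (f m <= f n)%E.

Definition terminal_count (f : nat -> \bar rat) (b : nat) : Prop :=
  is_argmax f b /\ forall n, is_argmax f n -> (b <= n)%N.

(* (x, y) is a convex combination of the points (n, f n), 0 <= n <= b.  A point
   with f n = -oo can only carry weight 0, because 0 * -oo = 0 in \bar rat. *)
Definition in_conv (f : nat -> \bar rat) (b : nat) (x y : rat) : Prop :=
  exists l : 'I_b.+1 -> rat,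
    [/\ forall n, 0 <= l n,
        \sum_n l n = 1,
        \sum_n l n * (val n)%:R = x &
        (\sum_n (l n)%:E * f (val n))%E = y%:E].

(* The upper concave hull at x is the largest ordinate over x in the convex hull
   of the points.  Rational weights suffice: the points are rational, so the
   maximum over real weights at a rational x is attained at rational ones. *)
Definition concave_hull_at (f : nat -> \bar rat) (b : nat) (x y : rat) : Prop :=
  in_conv f b x y /\ forall z, in_conv f b x z -> z <= y.

Definition is_hull (f : nat -> \bar rat) (b : nat) (H : b.+1.-tuple rat) : Prop :=
  forall k : 'I_b.+1, concave_hull_at f b (val k)%:R (tnth H k).

Definition realizes (I : instance) (bw br : nat)
    (Hw : bw.+1.-tuple rat) (Hr : br.+1.-tuple rat) : Prop :=
  [/\ valid I,
      terminal_count (U I (capD I)) bw,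
      terminal_count (U I (capR I)) br,
      is_hull (U I (capD I)) Hw &
      is_hull (U I (capR I)) Hr].

(* Main.v *)
Require Import Defs.
From HB Require Import structures.
From mathcomp Require Import all_boot all_order all_algebra.
From mathcomp Require Import constructive_ereal.
From mathcomp Require Import zify lra.
Set Implicit Arguments.
Unset Strict Implicit.
Unset Printing Implicit Defensive.
Import Order.TTheory GRing.Theory Num.Theory.
Local Open Scope ring_scope.

(** Up to their terminal counts both profiles are already concave, so the hulls
    are the profiles themselves.

    At capacity 12 every item is worth at most [a], and the two items of value
    [a] fill the knapsack exactly, so the profile starts 0, a, 2a.  Every
    feasible set is worth at most [3 * b] ([value_le_capD]), a value reached by
    the three items of value [b]; since [2 * a < 3 * b], no smaller set reaches
    it, and the terminal count is 3.  The increments a, a, 3b - 2a are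
    nonincreasing because [b <= a].

    At capacity 3 only the items [(u, 1)] and [(v, 2)] fit, and they fit
    together, so the profile is 0, u, u + v and then -oo; the terminal count is
    2 because [0 < v], and the increments are nonincreasing because [v <= u].

    The equality of hull and profile follows from supporting lines
    ([hull_of_support]).  Upper bounds on the profile depend on a set only
    through its numbers of items of each kind ([counts_of_set]), so that finitely
    many linear inequalities remain; lower bounds come from explicit sets
    ([U_ge]). *)

Lemma U_le (I : instance) (C n : nat) (y : rat) :
  (forall S : {set 'I_(size (items I))}, #|S| = n ->
     (\sum_(i in S) weight i <= C)%N -> \sum_(i in S) value i <= y) ->
  (U I C n <= y%:E)%E.
Proof.
move=> bound; apply/bigmax_leP; split=> [|S /andP[/eqP cardS wS]].
  by rewrite leNye.
by rewrite lee_fin; apply: bound.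
Qed.

(** Sums over a set of ordinals do not compute, sums over a list of positions do;
    exhibiting a feasible set as a list leaves side conditions that compute. *)
Lemma U_ge (I : instance) (C : nat) (s : seq nat) :
  uniq s -> all (gtn (size (items I))) s ->
  (\sum_(k <- s) (nth (0%R, 0%N) (items I) k).2 <= C)%N ->
  ((\sum_(k <- s) (nth (0, 0%N) (items I) k).1)%:E <= U I C (size s))%E.
Proof.
move=> uniqs boundS wS.
pose S := [set i : 'I_(size (items I)) | (i : nat) \in s].
have permS : perm_eq (map val (enum S)) s.
  apply: uniq_perm => //; first by rewrite map_inj_uniq ?enum_uniq //; exact: val_inj.
  move=> k; apply/mapP/idP => [[i + ->]|ks]; first by rewrite mem_enum inE.
  by exists (Ordinal (allP boundS k ks)); rewrite // mem_enum inE.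
have sumS (R : nmodType) (F : nat -> R) :
    \sum_(i in S) F i = \sum_(k <- s) F k.
  by rewrite -(perm_big _ permS) big_map big_enum.
have -> : \sum_(k <- s) (nth (0, 0%N) (items I) k).1 = \sum_(i in S) value i.
  by rewrite -sumS; apply: eq_bigr => i _; rewrite /value (tnth_nth (0, 0%N)).
apply: le_bigmax_cond; apply/andP; split.
  by rewrite cardE -(size_map val) (perm_size permS).
apply: leq_trans wS; rewrite -(sumS nat) leq_eqVlt; apply/orP; left; apply/eqP.
by apply: eq_bigr => i _; rewrite /weight (tnth_nth (0, 0%N)).
Qed.

Lemma terminal_countP (f : nat -> \bar rat) (b : nat) :
  (forall n, f n <= f b)%E -> (forall n, (n < b)%N -> (f n < f b)%E) ->
  terminal_count f b.
Proof.
move=> maxb ltb; split=> // n maxn; rewrite leqNgt; apply/negP=> /ltb.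
by rewrite ltNge (maxn b).
Qed.

(** A line of slope [s k] through the [k]-th point that dominates all the points
    also dominates their convex hull, whose ordinate over [k] is thus at most
    that of the [k]-th point. *)
Lemma hull_of_support (f : nat -> \bar rat) (b : nat) (H : b.+1.-tuple rat)
    (s : 'I_b.+1 -> rat) :
  (forall n : 'I_b.+1, f n = (tnth H n)%:E) ->
  (forall k n : 'I_b.+1,
     tnth H n <= tnth H k + s k * ((n : nat)%:R - (k : nat)%:R)) ->
  is_hull f H.
Proof.
move=> fH support k; split.
  exists (fun n => (n == k)%:R); split.
  - by move=> n; rewrite ler0n.
  - by rewrite (bigD1 k) //= eqxx big1 ?addr0 // => n /negbTE->.
  - rewrite (bigD1 k) //= eqxx mul1r big1 ?addr0 // => n /negbTE->.
    by rewrite mul0r.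
  - rewrite (bigD1 k) //= eqxx mul1e fH big1 ?adde0 // => n /negbTE->.
    by rewrite mul0e.
move=> z [l [l0 l1 lk lz]].
have {lz} <- : \sum_n l n * tnth H n = z.
  apply: EFin_inj; rewrite -lz -sumEFin; apply: eq_bigr => n _.
  by rewrite fH EFinM.
apply: (@le_trans _ _
  (\sum_n l n * (tnth H k + s k * ((n : nat)%:R - (k : nat)%:R)))).
  by apply: ler_sum => n _; apply: ler_wpM2l.
(* The weights have total mass 1 and mean k, so the line averages to its
   value at k. *)
rewrite le_eqVlt; apply/orP; left; apply/eqP.
transitivity (\sum_n l n * (tnth H k - s k * (k : nat)%:R)
              + \sum_n (l n * (n : nat)%:R) * s k).
  by rewrite -big_split; apply: eq_bigr => n _ /=; lra.
by rewrite -!mulr_suml l1 lk; lra.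
Qed.

Definition seven_items (a b u v : rat) : instance :=
  Instance [:: (b, 4%N); (b, 4%N); (b, 4%N); (a, 6%N); (a, 6%N);
               (u, 1%N); (v, 2%N)] 12 3.

Lemma sum_ord7 (R : nmodType) (S : {set 'I_7}) (F : nat -> R) :
  \sum_(i in S) F i = \sum_(0 <= k < 7) F k *+ (inord k \in S).
Proof.
rewrite big_mkord big_mkcond; apply: eq_bigr => i _.
by rewrite inord_val; case: ifP.
Qed.

(** Here [x], [y], [p], [q] count the chosen copies of [(b, 4)], [(a, 6)],
    [(u, 1)], [(v, 2)]; items of the same kind are interchangeable, which leaves
    48 cases instead of 128 sets. *)
Lemma counts_of_set (a b u v : rat)
    (S : {set 'I_(size (items (seven_items a b u v)))}) :
  exists x y p q : nat,
    [/\ [/\ (x <= 3)%N, (y <= 2)%N, (p <= 1)%N & (q <= 1)%N],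
        #|S| = (x + y + p + q)%N,
        (\sum_(i in S) weight i = 4 * x + 6 * y + p + 2 * q)%N &
        \sum_(i in S) value i = b * x%:R + a * y%:R + u * p%:R + v * q%:R].
Proof.
set I := seven_items a b u v in S *.
have -> : #|S| = \sum_(0 <= k < 7) 1 *+ (inord k \in S).
  by rewrite -sum1_card; exact: (sum_ord7 S (fun=> 1%N)).
have -> : (\sum_(i in S) weight i)%N =
    \sum_(0 <= k < 7) (nth (0, 0%N) (items I) k).2 *+ (inord k \in S).
  rewrite -(sum_ord7 S (fun k => (nth (0, 0%N) (items I) k).2)).
  by apply: eq_bigr => i _; rewrite /weight (tnth_nth (0, 0%N)).
have -> : \sum_(i in S) value i =
    \sum_(0 <= k < 7) (nth (0, 0%N) (items I) k).1 *+ (inord k \in S).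
  rewrite -(sum_ord7 S (fun k => (nth (0, 0%N) (items I) k).1)).
  by apply: eq_bigr => i _; rewrite /value (tnth_nth (0, 0%N)).
rewrite /index_iota /= !big_cons !big_nil /=.
do 7! [move: (_ \in S)] => c6 c5 c4 c3 c2 c1 c0.
exists (c0 + c1 + c2)%N, (c3 + c4)%N, c5, c6; split; last first.
- by rewrite !mulr_natr !mulrnDr addr0 !addrA.
- by case: c0 c1 c2 c3 c4 c5 c6 => [] [] [] [] [] [] [].
- by case: c0 c1 c2 c3 c4 c5 c6 => [] [] [] [] [] [] [].
- by case: c0 c1 c2 c3 c4 c5 c6 => [] [] [] [] [] [] [].
Qed.

Lemma value_le_card (a b u v : rat)
    (S : {set 'I_(size (items (seven_items a b u v)))}) :
  b <= a -> u <= a -> v <= a -> \sum_(i in S) value i <= a * #|S|%:R.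
Proof.
move=> hba hua hva.
have [x [y [p [q [_ -> _ ->]]]]] := counts_of_set S.
have := ler_wpM2r (ler0n rat x) hba; have := ler_wpM2r (ler0n rat p) hua.
by have := ler_wpM2r (ler0n rat q) hva; rewrite !natrD; lra.
Qed.

(** Each maximal feasible combination is compared with [3 * b] by one of the
    hypotheses: two items of value [a] by [2 * a / 3 < b], one of value [a], one
    of value [b] and a small one by [a + u <= 2 * b], and two of value [b] with
    both small ones by [u + v <= b], which also covers one of value [a] with both
    small ones because [a <= 2 * b]. *)
Lemma value_le_capD (a b u v : rat)
    (S : {set 'I_(size (items (seven_items a b u v)))}) :
  b <= a -> 2 * a / 3 < b -> v <= u -> 0 < v -> u + v <= b -> a + u <= 2 * b ->
  (\sum_(i in S) weight i <= 12)%N -> \sum_(i in S) value i <= 3 * b.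
Proof.
move=> hba hab hvu hv huv hau.
have [x [y [p [q [[x3 y2 p1 q1] _ -> ->]]]]] := counts_of_set S.
by case: x x3 => [|[|[|[|//]]]] _; case: y y2 => [|[|[|//]]] _;
  case: p p1 => [|[|//]] _; case: q q1 => [|[|//]] _ // _; lra.
Qed.

Lemma value_le_capR (a b u v : rat)
    (S : {set 'I_(size (items (seven_items a b u v)))}) :
  v <= u -> 0 < v -> (\sum_(i in S) weight i <= 3)%N ->
  \sum_(i in S) value i <= u + v /\ \sum_(i in S) value i <= u * #|S|%:R.
Proof.
move=> hvu hv.
have [x [y [p [q [[_ _ p1 q1] -> -> ->]]]]] := counts_of_set S.
move=> wS; have [-> ->] : x = 0%N /\ y = 0%N by lia.
by case: p p1 {wS} => [|[|//]] _; case: q q1 => [|[|//]] _; split; lra.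
Qed.

Theorem theorem4p4 (a b u v : rat)
    (hba : b <= a) (hab : 2 * a / 3 < b)
    (hvu : v <= u) (hv : 0 < v)
    (huv : u + v <= b) (hau : a + u <= 2 * b) :
  @realizes
    (Instance [:: (b, 4%N); (b, 4%N); (b, 4%N); (a, 6%N); (a, 6%N);
                  (u, 1%N); (v, 2%N)] 12 3)
    3 2
    [tuple 0; a; 2 * a; 3 * b]
    [tuple 0; u; u + v].
Proof.
rewrite -/(seven_items a b u v); set I := seven_items a b u v.
have leD n : (U I 12 n <= (3 * b)%:E)%E.
  by apply: U_le => S _ wS; apply: value_le_capD.
have leDn n : (U I 12 n <= (a * n%:R)%:E)%E.
  by apply: U_le => S <- _; apply: value_le_card; lra.
have leR n : (U I 3 n <= (u + v)%:E)%E.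
  by apply: U_le => S _ wS; have [] := value_le_capR hvu hv wS.
have leRn n : (U I 3 n <= (u * n%:R)%:E)%E.
  by apply: U_le => S <- wS; have [] := value_le_capR hvu hv wS.
have U_eq C s y :
    uniq s -> all (gtn 7) s ->
    (\sum_(k <- s) (nth (0%R, 0%N) (items I) k).2 <= C)%N ->
    \sum_(k <- s) (nth (0, 0%N) (items I) k).1 = y ->
    (U I C (size s) <= y%:E)%E -> U I C (size s) = y%:E.
  move=> us bs ws vs leUy; apply/eqP; rewrite eq_le leUy -vs /=.
  exact: U_ge.
have evalE := (big_cons, big_nil).
(* Positions 0-2 hold the items of value b, 3-4 those of value a, 5 and 6 those
   of values u and v. *)
have D0 : U I 12 0 = 0%:E.
  by apply: (U_eq 12 [::]); rewrite ?evalE // (le_trans (leDn _)) ?mulr0.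
have D1 : U I 12 1 = a%:E.
  by apply: (U_eq 12 [:: 3]); rewrite ?evalE ?addr0 // (le_trans (leDn _)) ?mulr1.
have D2 : U I 12 2 = (2 * a)%:E.
  by apply: (U_eq 12 [:: 3; 4]); rewrite ?evalE /= ?(le_trans (leDn _)) ?lee_fin //; lra.
have D3 : U I 12 3 = (3 * b)%:E.
  by apply: (U_eq 12 [:: 0; 1; 2]%N); rewrite ?evalE ?leD //=; lra.
have R0 : U I 3 0 = 0%:E.
  by apply: (U_eq 3 [::]); rewrite ?evalE // (le_trans (leRn _)) ?mulr0.
have R1 : U I 3 1 = u%:E.
  by apply: (U_eq 3 [:: 5]); rewrite ?evalE ?addr0 // (le_trans (leRn _)) ?mulr1.
have R2 : U I 3 2 = (u + v)%:E.
  by apply: (U_eq 3 [:: 5; 6]); rewrite ?evalE ?leR //=; lra.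
split.
- split=> // p.
  by rewrite !inE => /or4P[|||/or4P[]] /eqP-> /=; split=> //; lra.
- apply: terminal_countP => [n|]; rewrite [capD I]/= D3 //.
  by case=> [|[|[|//]]] _; rewrite ?D0 ?D1 ?D2 lte_fin; lra.
- apply: terminal_countP => [n|]; rewrite [capR I]/= R2 //.
  by case=> [|[|//]] _; rewrite ?R0 ?R1 lte_fin; lra.
- apply: (hull_of_support (s := tnth [tuple a; a; a; 3 * b - 2 * a])).
    by case=> [[|[|[|[|//]]]] lt_n]; rewrite (tnth_nth 0).
  move=> [[|[|[|[|//]]]] ?] [[|[|[|[|//]]]] ?];
    by rewrite !(tnth_nth 0) /=; lra.
- apply: (hull_of_support (s := tnth [tuple u; u; v])).
    by case=> [[|[|[|//]]] lt_n]; rewrite (tnth_nth 0).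
  move=> [[|[|[|//]]] ?] [[|[|[|//]]] ?];
    by rewrite !(tnth_nth 0) /=; lra.
Qed.
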